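(* Let $K\subset\mathbb{R}^2$ be a convex body and write $r=r(K)$, $w=w(K)$, $D=D(K)$, $R=R(K)$. Then \[ w\ \le\ 2r\left(1+\frac{2rR}{D^2}\left(1+\sqrt{1-\left(\frac{D}{2R}\right)^2}\right)\right). \]
   Context: For a convex body $K\subset\mathbb{R}^n$: $D(K)$ is the largest distance between two points of $K$; $w(K)$ is the smallest distance between two distinct parallel supporting lines/hyperplanes of $K$; $r(K)$ is the radius of a largest Euclidean ball contained in $K$; $R(K)$ is the radius of the smallest Euclidean ball containing $K$. *)

(* Defs.v *)
From Stdlib Require Import Reals Lra.
Open Scope R_scope.

Definition pt := (R * R)%type.

Definition dot (x y : pt) : R := fst x * fst y + snd x * snd y.
Definition dist2 (x y : pt) : R :=
  sqrt ((fst x - fst y) ^ 2 + (snd x - snd y) ^ 2).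

Definition cball (c : pt) (rho : R) : pt -> Prop := fun x => dist2 c x <= rho.

Definition convex_set (K : pt -> Prop) : Prop :=
  forall x y t, K x -> K y -> 0 <= t <= 1 ->
    K (t * fst x + (1 - t) * fst y, t * snd x + (1 - t) * snd y).

Definition closed_set (K : pt -> Prop) : Prop :=
  forall x, (forall eps, 0 < eps -> exists y, K y /\ dist2 x y < eps) -> K x.

Definition bounded_set (K : pt -> Prop) : Prop :=
  exists M, forall x, K x -> dist2 (0, 0) x <= M.

Definition nonempty_interior (K : pt -> Prop) : Prop :=
  exists c rho, 0 < rho /\ forall x, dist2 c x < rho -> K x.

Definition convex_body (K : pt -> Prop) : Prop :=
  convex_set K /\ closed_set K /\ bounded_set K /\ nonempty_interior K.

Definition is_diameter (K : pt -> Prop) (D : R) : Prop :=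
  (exists x y, K x /\ K y /\ dist2 x y = D) /\
  (forall x y, K x -> K y -> dist2 x y <= D).

(* Two distinct parallel supporting lines {z | <u,z> = c1} and {z | <u,z> = c2}
   (u a unit normal, c1 < c2): K lies between them and touches both.
   Their distance is c2 - c1. *)
Definition parallel_supporting_lines (K : pt -> Prop) (u : pt) (c1 c2 : R) : Prop :=
  dot u u = 1 /\ c1 < c2 /\
  (forall x, K x -> c1 <= dot u x <= c2) /\
  (exists x, K x /\ dot u x = c1) /\
  (exists x, K x /\ dot u x = c2).

Definition is_width (K : pt -> Prop) (w : R) : Prop :=
  (exists u c1 c2, parallel_supporting_lines K u c1 c2 /\ c2 - c1 = w) /\
  (forall u c1 c2, parallel_supporting_lines K u c1 c2 -> w <= c2 - c1).

Definition is_inradius (K : pt -> Prop) (r : R) : Prop :=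
  (exists c, forall x, cball c r x -> K x) /\
  (forall c rho, (forall x, cball c rho x -> K x) -> rho <= r).

Definition is_circumradius (K : pt -> Prop) (Rc : R) : Prop :=
  (exists c, forall x, K x -> cball c Rc x) /\
  (forall c rho, (forall x, K x -> cball c rho x) -> Rc <= rho).

(* Main.v *)
(* Let c be the incenter. By maximality of the inball the contact normals of K
   with the incircle are not contained in an open half plane, so (if w > 2r) three
   of them, u1, u2, u3, surround c and split the plane into three sectors.  Let
   x, y realise the diameter and pick a contact normal u bounding both the sector
   of x and the sector of y.  If p minimises <u, .> on K, then p lies at height
   h >= w above the tangent line with normal u, and the lines px and py meet the
   incircle disk.  Extending px and py to that tangent line gives a triangle, no
   side line of which is farther than r from c (seen from inside), so its inradius
   is at most r; for the angle phi at p this yields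
     cot(phi/2) >= q := D (w - 2r) / (2 r^2).
   If q > 1, the triangle pxy is acute with longest side D, whence
   R >= D / (2 sin phi) >= D (q + 1/q) / 4, which is the claim. *)
From Stdlib Require Import Reals Lra Psatz Classical.
Require Import Defs.
Open Scope R_scope.

(** * Vector algebra and distance in the plane *)

Definition vsub (x y : pt) : pt := (fst x - fst y, snd x - snd y).
Definition cross (x y : pt) : R := fst x * snd y - snd x * fst y.
Definition norm (x : pt) : R := sqrt (dot x x).

Ltac coords :=
  repeat match goal with z : pt |- _ => destruct z end;
  unfold vsub, cross, dot in *; simpl fst in *; simpl snd in *.

Lemma dot_self_nonneg x : 0 <= dot x x.
Proof. coords; nra. Qed.

Lemma norm_nonneg x : 0 <= norm x.
Proof. apply sqrt_pos. Qed.

Lemma norm_sqr x : norm x * norm x = dot x x.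
Proof. apply sqrt_sqrt, dot_self_nonneg. Qed.

Lemma dist2_norm x y : dist2 x y = norm (vsub x y).
Proof. unfold dist2, norm; f_equal; coords; ring. Qed.

Lemma dist2_sym x y : dist2 x y = dist2 y x.
Proof. unfold dist2; f_equal; ring. Qed.

Lemma dist2_sqr x y : dist2 x y * dist2 x y = dot (vsub x y) (vsub x y).
Proof. rewrite dist2_norm; apply norm_sqr. Qed.

Lemma dist2_nonneg x y : 0 <= dist2 x y.
Proof. apply sqrt_pos. Qed.

Lemma lagrange x y : dot x x * dot y y = dot x y * dot x y + cross x y * cross x y.
Proof. coords; ring. Qed.

Lemma le_of_sqr a b : 0 <= b -> a * a <= b * b -> a <= b.
Proof. intros; nra. Qed.

Lemma dot_le_norm x y : dot x y <= norm x * norm y.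
Proof.
  apply le_of_sqr.
  - apply Rmult_le_pos; apply norm_nonneg.
  - replace (norm x * norm y * (norm x * norm y))
      with ((norm x * norm x) * (norm y * norm y)) by ring.
    rewrite !norm_sqr, lagrange. nra.
Qed.

Lemma abs_dot_le x y : Rabs (dot x y) <= norm x * norm y.
Proof.
  apply Rabs_le; split; [|apply dot_le_norm].
  assert (H := dot_le_norm (- fst x, - snd x) y).
  replace (norm (- fst x, - snd x)) with (norm x) in H
    by (unfold norm; f_equal; coords; ring).
  replace (dot (- fst x, - snd x) y) with (- dot x y) in H by (coords; ring).
  lra.
Qed.

Lemma norm_unit u : dot u u = 1 -> norm u = 1.
Proof. intros H; unfold norm; rewrite H; apply sqrt_1. Qed.

Lemma dist2_triangle x y z : dist2 x z <= dist2 x y + dist2 y z.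
Proof.
  assert (Hxy := dist2_nonneg x y); assert (Hyz := dist2_nonneg y z).
  apply le_of_sqr; [lra|].
  assert (H := dot_le_norm (vsub x y) (vsub y z)).
  rewrite <- !dist2_norm in H.
  assert (H1 := dist2_sqr x y); assert (H2 := dist2_sqr y z).
  rewrite dist2_sqr.
  replace (dot (vsub x z) (vsub x z)) with
    (dot (vsub x y) (vsub x y) + dot (vsub y z) (vsub y z)
     + 2 * dot (vsub x y) (vsub y z)) by (coords; ring).
  nra.
Qed.

Lemma dist2_self x : dist2 x x = 0.
Proof.
  unfold dist2. replace (_ + _) with 0 by ring. apply sqrt_0.
Qed.

Lemma fst_le_dist2 x y : Rabs (fst x - fst y) <= dist2 x y.
Proof.
  unfold dist2; rewrite <- sqrt_Rsqr_abs; apply sqrt_le_1_alt; unfold Rsqr.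
  simpl; assert (H1 := Rle_0_sqr (fst x - fst y)); assert (H2 := Rle_0_sqr (snd x - snd y)); unfold Rsqr in *; lra.
Qed.

Lemma snd_le_dist2 x y : Rabs (snd x - snd y) <= dist2 x y.
Proof.
  unfold dist2; rewrite <- sqrt_Rsqr_abs; apply sqrt_le_1_alt; unfold Rsqr.
  simpl; assert (H1 := Rle_0_sqr (fst x - fst y)); assert (H2 := Rle_0_sqr (snd x - snd y)); unfold Rsqr in *; lra.
Qed.

Lemma dist2_le_abs x y :
  dist2 x y <= Rabs (fst x - fst y) + Rabs (snd x - snd y).
Proof.
  assert (H1 := Rabs_pos (fst x - fst y)); assert (H2 := Rabs_pos (snd x - snd y)).
  apply le_of_sqr; [lra|]. rewrite dist2_sqr.
  assert (E : forall t, Rabs t * Rabs t = t * t)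
    by (intros t; rewrite <- Rabs_mult; apply Rabs_pos_eq; nra).
  assert (E1 := E (fst x - fst y)); assert (E2 := E (snd x - snd y)).
  unfold dot, vsub; simpl fst; simpl snd. nra.
Qed.

(** * Compactness, attained extrema and separation *)

(** The sets [A e] shrink with [e]; the cluster point [a0] is their upper limit, the supremum of the
    numbers that every [A e] reaches or exceeds. Stating compactness for shrinking families avoids
    sequences and choice. *)
Lemma cluster_real (A : R -> R -> Prop) (M : R) :
  (forall e, 0 < e -> exists a, A e a) ->
  (forall e a, 0 < e -> A e a -> Rabs a <= M) ->
  (forall e e' a, 0 < e <= e' -> A e a -> A e' a) ->
  exists a0, forall e, 0 < e -> exists a, A e a /\ Rabs (a - a0) < e.
Proof.
  intros Hne Hb Hm.
  destruct (completeness (fun t => forall e, 0 < e -> exists a, A e a /\ t <= a))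
    as [a0 [Hub Hlub]].
  - exists M. intros t Ht. destruct (Ht 1 Rlt_0_1) as [a [Ha Hta]].
    apply Hb in Ha; [|lra].
    assert (H := Rle_abs a). lra.
  - exists (- M). intros e He. destruct (Hne e He) as [a Ha]. exists a; split; auto.
    apply Hb in Ha; auto. assert (H := Rle_abs (- a)). rewrite Rabs_Ropp in H. lra.
  - exists a0. intros e He.
    assert (exists e1, 0 < e1 /\ forall a, A e1 a -> a < a0 + e) as [e1 [He1 H1]].
    { apply NNPP; intros Hn.
      assert (a0 + e <= a0); [|lra].
      apply Hub. intros e1 He1. apply NNPP; intros Hn1. apply Hn.
      exists e1; split; auto. intros a Ha. apply Rnot_le_lt; intros Hle.
      apply Hn1. exists a; auto. }
    assert (exists t, a0 - e < t /\ forall e, 0 < e -> exists a, A e a /\ t <= a)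
      as [t [Ht Ht']].
    { apply NNPP; intros Hn.
      assert (a0 <= a0 - e); [|lra].
      apply Hlub. intros t Ht. apply Rnot_lt_le; intros Hlt.
      apply Hn; exists t; auto. }
    assert (Hmin : 0 < Rmin e e1) by (apply Rmin_pos; auto).
    assert (Hl := Rmin_l e e1); assert (Hr := Rmin_r e e1).
    destruct (Ht' _ Hmin) as [a [Ha Hta]]. exists a; split.
    + apply Hm with (2 := Ha); lra.
    + assert (a < a0 + e) by (apply H1; apply Hm with (2 := Ha); lra).
      apply Rabs_def1; lra.
Qed.

(** The real case is used twice: for first coordinates, then for second coordinates of those points
    whose first coordinate is already within [e] of [a0]. *)
Lemma cluster_pt (A : R -> pt -> Prop) (M : R) :
  (forall e, 0 < e -> exists z, A e z) ->
  (forall e z, 0 < e -> A e z -> dist2 (0, 0) z <= M) ->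
  (forall e e' z, 0 < e <= e' -> A e z -> A e' z) ->
  exists z0, forall e, 0 < e -> exists z, A e z /\ dist2 z0 z < e.
Proof.
  intros Hne Hb Hm.
  destruct (cluster_real (fun e a => exists b, A e (a, b)) M) as [a0 Ha0].
  - intros e He. destruct (Hne e He) as [[a b] H]. exists a, b; auto.
  - intros e a He [b H]. apply Hb in H; auto.
    assert (H1 := fst_le_dist2 (0, 0) (a, b)). simpl in H1.
    rewrite Rminus_0_l, Rabs_Ropp in H1. lra.
  - intros e e' a He [b H]. exists b; eauto.
  - destruct (cluster_real (fun e b => exists a, A e (a, b) /\ Rabs (a - a0) < e) M)
      as [b0 Hb0].
    + intros e He. destruct (Ha0 e He) as [a [[b H] H']]. exists b, a; auto.
    + intros e b He [a [H _]]. apply Hb in H; auto.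
      assert (H1 := snd_le_dist2 (0, 0) (a, b)). simpl in H1.
      rewrite Rminus_0_l, Rabs_Ropp in H1. lra.
    + intros e e' b He [a [H H']]. exists a; split; [eauto|lra].
    + exists (a0, b0). intros e He.
      destruct (Hb0 (e / 2)) as [b [[a [H H1]] H2]]; [lra|].
      exists (a, b); split.
      * apply Hm with (2 := H); lra.
      * assert (H3 := dist2_le_abs (a0, b0) (a, b)). simpl in H3.
        rewrite (Rabs_minus_sym a0), (Rabs_minus_sym b0) in H3. lra.
Qed.

Lemma le_of_le_add_eps a b C :
  0 <= C -> (forall e, 0 < e -> a <= b + C * e) -> a <= b.
Proof.
  intros HC H. apply Rnot_lt_le; intros Hlt.
  assert (H1 := H ((a - b) / (2 * (C + 1)))).
  assert (0 < (a - b) / (2 * (C + 1))) by (apply Rdiv_lt_0_compat; lra).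
  assert (((a - b) / (2 * (C + 1))) * (2 * (C + 1)) = a - b) by (field; lra).
  specialize (H1 H0). nra.
Qed.

(** The maximiser is a cluster point of the near-maximisers. It serves for linear functionals and
    for the distance to a point with its sign reversed. *)
Lemma lipschitz_max (K : pt -> Prop) (f : pt -> R) (L : R) :
  closed_set K -> bounded_set K -> (exists x, K x) -> 0 <= L ->
  (forall x y, f x <= f y + L * dist2 x y) ->
  exists x, K x /\ forall y, K y -> f y <= f x.
Proof.
  intros Hc [M HM] [x1 Hx1] HL Hf.
  destruct (completeness (fun t => exists x, K x /\ t = f x)) as [m [Hub Hlub]].
  - exists (f (0, 0) + L * M). intros t [x [Hx ->]].
    assert (H := Hf x (0, 0)). rewrite dist2_sym in H.
    specialize (HM x Hx). nra.
  - exists (f x1), x1; auto.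
  - destruct (cluster_pt (fun e x => K x /\ m - e <= f x) M) as [x0 Hx0].
    + intros e He. apply NNPP; intros Hn.
      assert (m <= m - e); [|lra].
      apply Hlub. intros t [x [Hx ->]]. apply Rnot_lt_le; intros Hlt.
      apply Hn. exists x; split; auto; lra.
    + intros e z He [Hz _]; auto.
    + intros e e' z He [Hz H]; split; auto; lra.
    + exists x0; split.
      * apply Hc. intros e He. destruct (Hx0 e He) as [z [[Hz _] H]]. exists z; auto.
      * intros y Hy. apply Rle_trans with m; [apply Hub; exists y; auto|].
        apply (le_of_le_add_eps m (f x0) (1 + L)); [lra|].
        intros e He. destruct (Hx0 e He) as [z [[Hz H] Hd]].
        assert (H1 := Hf z x0). rewrite dist2_sym in H1. nra.
Qed.

Lemma dot_lipschitz u x y : dot u x <= dot u y + norm u * dist2 x y.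
Proof.
  assert (H := dot_le_norm u (vsub x y)). rewrite <- dist2_norm in H.
  replace (dot u (vsub x y)) with (dot u x - dot u y) in H by (coords; ring). lra.
Qed.

Lemma linear_max (K : pt -> Prop) (u : pt) :
  closed_set K -> bounded_set K -> (exists x, K x) ->
  exists x, K x /\ forall y, K y -> dot u y <= dot u x.
Proof.
  intros Hc Hb Hne.
  apply (lipschitz_max K (dot u) (norm u)); auto using norm_nonneg.
  intros; apply dot_lipschitz.
Qed.

Lemma linear_min (K : pt -> Prop) (u : pt) :
  closed_set K -> bounded_set K -> (exists x, K x) ->
  exists x, K x /\ forall y, K y -> dot u x <= dot u y.
Proof.
  intros Hc Hb Hne.
  destruct (linear_max K (- fst u, - snd u)) as [x [Hx H]]; auto.
  exists x; split; auto. intros y Hy. specialize (H y Hy).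
  replace (dot (- fst u, - snd u) y) with (- dot u y) in H by (coords; ring).
  replace (dot (- fst u, - snd u) x) with (- dot u x) in H by (coords; ring).
  lra.
Qed.

(** The normal points from the nearest point [y] of [K] towards [z]. *)
Lemma separation (K : pt -> Prop) (z : pt) :
  convex_set K -> closed_set K -> bounded_set K -> (exists x, K x) -> ~ K z ->
  exists u, dot u u = 1 /\ forall k, K k -> dot u k <= dot u z.
Proof.
  intros Hcv Hc Hb Hne Hz.
  destruct (lipschitz_max K (fun x => - dist2 z x) 1) as [y [Hy Hmin]]; auto; try lra.
  { intros a b. assert (H := dist2_triangle z a b). lra. }
  assert (Hd : 0 < dist2 z y).
  { destruct (dist2_nonneg z y) as [H|H]; auto. exfalso; apply Hz, Hc.
    intros e He. exists y; split; auto; lra. }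
  (* A point of the segment from [y] to [k], taken close to [y], is no nearer to [z] than [y] is; to
     first order in [t] this says that the angle at [y] is not acute. *)
  assert (Hobt : forall k, K k -> dot (vsub z y) (vsub k y) <= 0).
  { intros k Hk.
    apply (le_of_le_add_eps _ 0 (dot (vsub k y) (vsub k y))).
    apply dot_self_nonneg.
    intros e He. set (t := Rmin e 1).
    assert (Ht : 0 < t <= 1 /\ t <= e).
    { unfold t. assert (0 < Rmin e 1) by (apply Rmin_pos; lra).
      assert (H1 := Rmin_l e 1); assert (H2 := Rmin_r e 1). lra. }
    assert (H := Hmin _ (Hcv k y t Hk Hy ltac:(lra))). simpl in H.
    match type of H with - dist2 z ?q <= _ => set (q0 := q) in H end.
    assert (H1 : dist2 z y * dist2 z y <= dist2 z q0 * dist2 z q0).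
    { assert (H2 := dist2_nonneg z q0). nra. }
    rewrite !dist2_sqr in H1.
    replace (dot (vsub z q0) (vsub z q0)) with
      (dot (vsub z y) (vsub z y) - 2 * t * dot (vsub z y) (vsub k y)
       + t * t * dot (vsub k y) (vsub k y)) in H1
      by (unfold q0; clear; coords; ring).
    assert (H3 := dot_self_nonneg (vsub k y)).
    assert (2 * dot (vsub z y) (vsub k y) <= t * dot (vsub k y) (vsub k y))
      by (apply Rmult_le_reg_l with t; lra).
    nra. }
  exists ((fst z - fst y) / dist2 z y, (snd z - snd y) / dist2 z y).
  assert (E := dist2_sqr z y).
  split.
  - unfold dot at 1; simpl fst; simpl snd.
    apply Rmult_eq_reg_r with (dist2 z y * dist2 z y); [|nra].
    rewrite Rmult_1_l. rewrite E at 2. unfold dot, vsub; simpl. field. lra.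
  - intros k Hk.
    assert (H1 : forall x, dot ((fst z - fst y) / dist2 z y, (snd z - snd y) / dist2 z y) x
       = / dist2 z y * dot (vsub z y) x)
      by (intros x; unfold dot, vsub; simpl; field; lra).
    rewrite !H1. apply Rmult_le_compat_l; [left; apply Rinv_0_lt_compat; auto|].
    specialize (Hobt k Hk). assert (H3 := dot_self_nonneg (vsub z y)).
    replace (dot (vsub z y) (vsub k y)) with (dot (vsub z y) k - dot (vsub z y) y) in Hobt
      by (clear; coords; ring).
    replace (dot (vsub z y) (vsub z y)) with (dot (vsub z y) z - dot (vsub z y) y) in H3
      by (clear; coords; ring).
    lra.
Qed.

(** * Sectors around the incenter and caps cut off by tangents *)

(* The line through u crosses the segment zz' at a multiple k u with k <= r; since
   that point lies in the cap {<n, .> > r}, k must be negative, i.e. the segment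
   passes behind the origin as seen from u. *)
Lemma cap_cross (u n z z' : pt) (r : R) :
  dot u u = 1 -> dot n n = 1 -> 0 < r ->
  dot u z <= r -> dot u z' <= r -> r < dot n z -> r < dot n z' ->
  cross u z <= 0 <= cross u z' ->
  cross z z' < 0 \/ (cross u z = 0 /\ cross u z' = 0).
Proof.
  intros Hu Hn Hr Huz Huz' Hnz Hnz' [Hz Hz'].
  destruct (Rlt_le_dec (cross z z') 0) as [|Hc]; [left; auto|right].
  (* [E1] and [E2] pair the vector identity [cross u z'] z - [cross u z] z' = [cross z z'] u with
     [u] and with [n]. *)
  assert (E1 : cross u z' * dot u z - cross u z * dot u z' = cross z z').
  { transitivity (dot u u * cross z z'); [clear; coords; ring|rewrite Hu; ring]. }
  assert (E2 : cross u z' * dot n z - cross u z * dot n z' = dot n u * cross z z').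
  { clear; coords; ring. }
  assert (H1 : dot n u <= 1).
  { assert (H := dot_le_norm n u). rewrite !norm_unit in H; auto; lra. }
  assert (dot n u * cross z z' <= cross z z') by nra.
  assert (0 <= cross u z' * (dot n z - r)) by (apply Rmult_le_pos; lra).
  assert (0 <= - cross u z * (dot n z' - r)) by (apply Rmult_le_pos; lra).
  assert (0 <= cross u z' * (r - dot u z)) by (apply Rmult_le_pos; lra).
  assert (0 <= - cross u z * (r - dot u z')) by (apply Rmult_le_pos; lra).
  assert (A1 : cross u z' * (dot n z - r) = 0) by lra.
  assert (A2 : - cross u z * (dot n z' - r) = 0) by lra.
  apply Rmult_integral in A1; apply Rmult_integral in A2. lra.
Qed.

(** Each of the three successive turns is counterclockwise by less than a half turn, so together
    they go once around the origin. *)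
Definition positively_oriented (u v w : pt) : Prop :=
  0 < cross u v /\ 0 < cross v w /\ 0 < cross w u.

(** A point of the sector is a nonnegative combination of [u] and [v], so its inner products with
    them have a nonnegative sum; one below [- r] and the other at most [r] would make the sum
    negative. *)
Lemma far_point_not_in_sector (u v p : pt) (r : R) :
  dot u u = 1 -> dot v v = 1 -> 0 < cross u v ->
  dot u p <= r -> dot v p <= r -> dot u p < - r \/ dot v p < - r ->
  ~ (0 <= cross u p /\ cross v p <= 0).
Proof.
  intros Hu Hv Huv H1 H2 H3 [H4 H5].
  assert (Hc : Rabs (dot u v) <= 1).
  { assert (H := abs_dot_le u v). rewrite !norm_unit in H; auto; lra. }
  assert (-1 <= dot u v <= 1) as Hd.
  { revert Hc. unfold Rabs. destruct (Rcase_abs _); lra. }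
  assert (E1 : cross u v * dot u p = - cross v p + cross u p * dot u v).
  { transitivity (- cross v p * dot u u + cross u p * dot u v);
      [clear; coords; ring|rewrite Hu; ring]. }
  assert (E2 : cross u v * dot v p = - cross v p * dot u v + cross u p).
  { transitivity (- cross v p * dot u v + cross u p * dot v v);
      [clear; coords; ring|rewrite Hv; ring]. }
  assert (cross u v * (dot u p + dot v p) = (cross u p - cross v p) * (1 + dot u v)) by lra.
  assert (0 <= (cross u p - cross v p) * (1 + dot u v)) by (apply Rmult_le_pos; lra).
  assert (dot u p + dot v p < 0) by lra. nra.
Qed.

Lemma sign_triple (a1 a2 a3 s1 s2 s3 : R) :
  0 < a1 -> 0 < a2 -> 0 < a3 -> a1 * s1 + a2 * s2 + a3 * s3 = 0 ->
  (0 <= s1 /\ s2 <= 0) \/ (0 <= s2 /\ s3 <= 0) \/ (0 <= s3 /\ s1 <= 0).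
Proof.
  intros H1 H2 H3 E.
  destruct (Rle_lt_dec 0 s1), (Rle_lt_dec 0 s2), (Rle_lt_dec 0 s3);
  destruct (Rle_lt_dec s1 0), (Rle_lt_dec s2 0), (Rle_lt_dec s3 0);
   try lra; exfalso; nra.
Qed.

(** The three cross products with [z] satisfy a linear relation with positive coefficients, so in
    cyclic order their sign passes somewhere from nonnegative to nonpositive. *)
Lemma sector_cover (u v w z : pt) :
  positively_oriented u v w ->
  (0 <= cross u z /\ cross v z <= 0) \/ (0 <= cross v z /\ cross w z <= 0) \/
  (0 <= cross w z /\ cross u z <= 0).
Proof.
  intros (H1 & H2 & H3).
  apply (sign_triple (cross v w) (cross w u) (cross u v)); auto.
  clear; coords; ring.
Qed.

(** Being far below [uk], the point [p] lies in the sector of [ui] and [uj], while [x] lies in the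
    adjacent one. A segment inside a cap would have to pass behind the origin as seen from [uj], and
    the signs of the cross products exclude this. *)
Lemma no_common_cap_left (ui uj uk n p x : pt) (r : R) :
  0 < r -> dot ui ui = 1 -> dot uj uj = 1 -> dot uk uk = 1 -> dot n n = 1 ->
  positively_oriented ui uj uk ->
  dot ui p <= r -> dot uj p <= r -> dot uk p < - r ->
  dot ui x <= r -> dot uj x <= r -> dot uk x <= r ->
  0 <= cross uj x -> cross uk x <= 0 ->
  r < dot n p -> r < dot n x -> False.
Proof.
  intros Hr Hi Hj Hk Hn Hor Hip Hjp Hkp Hix Hjx Hkx Hsj Hsk Hnp Hnx.
  assert (Hp : 0 <= cross ui p /\ cross uj p <= 0).
  { destruct (sector_cover _ _ _ p Hor) as [H|[H|H]]; auto; exfalso; revert H;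
      destruct Hor as (? & ? & ?).
    - apply (far_point_not_in_sector uj uk p r); auto; lra.
    - apply (far_point_not_in_sector uk ui p r); auto; lra. }
  destruct Hp as [Hpi Hpj]. destruct Hor as (Oij & Ojk & Oki).
  assert (E : cross uj uk * cross x p = - cross uk x * cross uj p + cross uj x * cross uk p)
    by (clear; coords; ring).
  destruct (cap_cross uj n p x r) as [Hc|[H1 H2]]; auto; try lra.
  - assert (Hxp : 0 < cross x p).
    { replace (cross x p) with (- cross p x) by (clear; coords; ring). lra. }
    assert (Hkp' : cross uk p < 0).
    { apply Rnot_le_lt; intros H.
      destruct (cap_cross uk n x p r) as [Hc'|[H1 H2]]; auto; try lra.
      rewrite H1, H2 in E. nra. }
    assert (0 < cross uj uk * cross x p) by nra.
    nra.
  (* Degenerate case: [x] is a nonnegative multiple of [uj] of length at most [r], hence not in the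
     cap. *)
  - assert (E1 : cross uj uk * dot uj x = - cross uk x + cross uj x * dot uj uk).
    { transitivity (- cross uk x * dot uj uj + cross uj x * dot uj uk);
        [clear; coords; ring|rewrite Hj; ring]. }
    assert (E2 : dot n x = dot uj x * dot n uj).
    { transitivity (dot n x * dot uj uj); [rewrite Hj; ring|].
      transitivity (dot uj x * dot n uj + cross uj x * cross uj n);
        [clear; coords; ring|rewrite H2; ring]. }
    assert (H3 : dot n uj <= 1).
    { assert (H := dot_le_norm n uj). rewrite !norm_unit in H; auto; lra. }
    rewrite H2 in E1.
    assert (0 <= dot uj x) by nra. nra.
Qed.

Lemma no_common_cap (ui uj uk n p x : pt) (r : R) :
  0 < r -> dot ui ui = 1 -> dot uj uj = 1 -> dot uk uk = 1 -> dot n n = 1 ->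
  positively_oriented ui uj uk ->
  dot ui p <= r -> dot uj p <= r -> dot uk p < - r ->
  dot ui x <= r -> dot uj x <= r -> dot uk x <= r ->
  (0 <= cross uj x /\ cross uk x <= 0) \/ (0 <= cross uk x /\ cross ui x <= 0) ->
  r < dot n p -> r < dot n x -> False.
Proof.
  intros Hr Hi Hj Hk Hn Hor Hip Hjp Hkp Hix Hjx Hkx [[H1 H2]|[H1 H2]] Hnp Hnx.
  - apply (no_common_cap_left ui uj uk n p x r); auto.
  (* Reflection in the first axis reverses orientation and so exchanges the roles of [ui] and
     [uj]. *)
  - set (f := fun z : pt => (fst z, - snd z)).
    assert (Ed : forall a b, dot (f a) (f b) = dot a b)
      by (intros; unfold f; coords; ring).
    assert (Ec : forall a b, cross (f a) (f b) = - cross a b)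
      by (intros; unfold f; coords; ring).
    assert (Ea : forall a b, cross a b = - cross b a) by (intros; coords; ring).
    destruct Hor as (Oij & Ojk & Oki).
    apply (no_common_cap_left (f uj) (f ui) (f uk) (f n) (f p) (f x) r);
      rewrite ?Ed, ?Ec; auto; try lra.
    unfold positively_oriented. rewrite !Ec, <- !Ea. auto.
Qed.

(** The quotient of [Rabs (cross p x)] by the length of [vsub x p] is the distance from the origin
    to the line px. If it exceeded [r], the unit normal pointing away from the origin would give a
    cap containing both points. *)
Lemma line_distance (p x : pt) (r : R) :
  (forall n, dot n n = 1 -> r < dot n p -> r < dot n x -> False) ->
  0 < r -> Rabs (cross p x) <= r * norm (vsub x p).
Proof.
  intros H Hr. apply Rnot_lt_le; intros Hlt.
  assert (Hn := norm_nonneg (vsub x p)).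
  assert (E := norm_sqr (vsub x p)).
  set (d := norm (vsub x p)) in *.
  assert (Hd : 0 < d).
  { destruct Hn as [|Hn]; auto. exfalso.
    rewrite <- Hn in Hlt, E. rewrite Rmult_0_r in Hlt.
    replace (cross p x) with (cross p (vsub x p)) in Hlt by (clear; coords; ring).
    assert (L := lagrange p (vsub x p)). rewrite <- E in L.
    assert (cross p (vsub x p) = 0) by nra. rewrite H0, Rabs_R0 in Hlt. lra. }
  assert (exists s, s * s = 1 /\ s * cross p x = Rabs (cross p x)) as [s [Hs Es]].
  { unfold Rabs; destruct (Rcase_abs _); [exists (-1)|exists 1]; lra. }
  assert (Hr' : r < Rabs (cross p x) / d).
  { apply Rmult_lt_reg_r with d; auto. unfold Rdiv.
    rewrite Rmult_assoc, Rinv_l; lra. }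
  set (n := (s * (snd x - snd p) / d, - (s * (fst x - fst p) / d))).
  assert (Ep : dot n p = Rabs (cross p x) / d).
  { rewrite <- Es. unfold n, dot, cross; simpl. field. lra. }
  assert (Ex : dot n x = Rabs (cross p x) / d).
  { rewrite <- Es. unfold n, dot, cross; simpl. field. lra. }
  apply (H n); [|lra|lra].
  apply Rmult_eq_reg_r with (d * d); [|nra]. rewrite E at 2.
  transitivity (s * s * dot (vsub x p) (vsub x p)); [|rewrite Hs; ring].
  unfold n, dot, vsub; simpl. field. lra.
Qed.

(** * Contact normals of the incircle *)

(** Contact itself is not stated: once the ball of radius [r] about [c] lies in [K], its boundary
    point in direction [u] attains the bound. *)
Definition contact_direction (K : pt -> Prop) (c : pt) (r : R) (u : pt) : Prop :=
  dot u u = 1 /\ forall k, K k -> dot u (vsub k c) <= r.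

Lemma dot_le_dist2 u v z : dot u z <= dot v z + norm z * dist2 u v.
Proof.
  assert (H := dot_lipschitz z u v).
  replace (dot z u) with (dot u z) in H by (clear; coords; ring).
  replace (dot z v) with (dot v z) in H by (clear; coords; ring). auto.
Qed.

Lemma unit_closed (u : pt) :
  (forall e, 0 < e -> exists z, dot z z = 1 /\ dist2 u z < e) -> dot u u = 1.
Proof.
  intros H. rewrite <- norm_sqr.
  assert (Hu := norm_nonneg u).
  assert (Hd : forall z, dot z z = 1 -> norm u <= 1 + dist2 u z /\ 1 <= norm u + dist2 u z).
  { intros z Hz.
    assert (N : forall t, norm t = dist2 t (0, 0))
      by (intros; rewrite dist2_norm; unfold norm; f_equal; clear; coords; ring).
    assert (H1 := dist2_triangle u z (0, 0)). assert (H2 := dist2_triangle z u (0, 0)).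
    rewrite <- !N in *. rewrite (dist2_sym z u) in H2.
    rewrite (norm_unit z Hz) in *. lra. }
  assert (norm u <= 1).
  { apply (le_of_le_add_eps _ _ 1); [lra|]. intros e He.
    destruct (H e He) as [z [Hz Hz']]. destruct (Hd z Hz). lra. }
  assert (1 <= norm u).
  { apply (le_of_le_add_eps _ _ 1); [lra|]. intros e He.
    destruct (H e He) as [z [Hz Hz']]. destruct (Hd z Hz). lra. }
  nra.
Qed.

Lemma contact_direction_closed (K : pt -> Prop) (c : pt) (r : R) :
  closed_set (contact_direction K c r).
Proof.
  intros u H; split.
  - apply unit_closed.
    intros e He. destruct (H e He) as [z [[Hz _] Hd]]. exists z; auto.
  - intros k Hk. apply (le_of_le_add_eps _ _ (norm (vsub k c))); [apply norm_nonneg|].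
    intros e He. destruct (H e He) as [z [[_ Hz] Hd]].
    specialize (Hz k Hk). assert (H1 := dot_le_dist2 u z (vsub k c)).
    assert (H2 := norm_nonneg (vsub k c)). nra.
Qed.

Lemma ball_point (K : pt -> Prop) (c u : pt) (r s : R) :
  (forall x, cball c r x -> K x) -> dot u u = 1 -> Rabs s <= r ->
  K (fst c + s * fst u, snd c + s * snd u).
Proof.
  intros H Hu Hs. apply H. unfold cball.
  assert (Hp := Rabs_pos s).
  apply le_of_sqr; [lra|]. rewrite dist2_sqr.
  replace (dot _ _) with (s * s * dot u u) by (clear; coords; ring).
  rewrite Hu, Rmult_1_r.
  replace (s * s) with (Rabs s * Rabs s)
    by (rewrite <- Rabs_mult; apply Rabs_pos_eq; nra).
  nra.
Qed.

(** First variation of the inball: if all contact normals made an obtuse angle with [v], moving the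
    ball along [v] would leave room to enlarge it. *)
Lemma contact_direction_exists (K : pt -> Prop) (c v : pt) (r : R) :
  convex_set K -> closed_set K -> bounded_set K -> 0 < r ->
  (forall x, cball c r x -> K x) ->
  (forall c' rho, (forall x, cball c' rho x -> K x) -> rho <= r) ->
  exists u, contact_direction K c r u /\ 0 <= dot u v.
Proof.
  intros Hcv Hcl Hb Hr Hin Hmax.
  assert (Hne : exists x, K x).
  { exists c. apply Hin. unfold cball. rewrite dist2_self. lra. }
  assert (Hv := norm_nonneg v).
  (* Approximate contact normals. The slack [(norm v + 1) * e] covers the shift by [e] times [v] and
     the growth [e * e], which is at most [e]. *)
  set (A := fun e u => dot u u = 1 /\ - e <= dot u v /\
              forall k, K k -> dot u (vsub k c) <= r + (norm v + 1) * e).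
  assert (HA1 : forall e, 0 < e <= 1 -> exists u, A e u).
  { (* The ball of radius r + e^2 about c + e v sticks out of K at some z; separate z from K. *)
    intros e He.
    assert (exists z, dist2 (fst c + e * fst v, snd c + e * snd v) z <= r + e * e /\ ~ K z)
      as [z [Hz Hnz]].
    { apply NNPP; intros Hn.
      assert (r + e * e <= r); [|nra].
      apply (Hmax (fst c + e * fst v, snd c + e * snd v)). intros x Hx.
      apply NNPP; intros HK. apply Hn. exists x; auto. }
    destruct (separation K z Hcv Hcl Hb Hne Hnz) as [u [Hu Hsep]].
    assert (Hk := Hsep _ (ball_point K c u r r Hin Hu ltac:(rewrite Rabs_pos_eq; lra))).
    assert (H1 := dot_lipschitz u z (fst c + e * fst v, snd c + e * snd v)).
    rewrite dist2_sym, norm_unit in H1; auto.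
    replace (dot u (fst c + r * fst u, snd c + r * snd u)) with (dot u c + r * dot u u) in Hk
      by (clear; coords; ring). rewrite Hu in Hk.
    replace (dot u (fst c + e * fst v, snd c + e * snd v)) with (dot u c + e * dot u v) in H1
      by (clear; coords; ring).
    assert (H2 := dot_le_norm u v). rewrite (norm_unit u) in H2; auto.
    exists u; split; [auto|split].
    (* Comparing [z] with the boundary point of the inball in direction [u] gives
       [0 <= e * dot u v + e * e]; growth of second order survives division by [e]. *)
    - apply Rmult_le_reg_l with e; nra.
    - intros k Hkk. specialize (Hsep k Hkk).
      replace (dot u (vsub k c)) with (dot u k - dot u c) by (clear; coords; ring).
      nra. }
  assert (HAm : forall e e' u, 0 < e <= e' -> A e u -> A e' u).
  { intros e e' u He (H1 & H2 & H3). split; [auto|split; [lra|]].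
    intros k Hk. specialize (H3 k Hk). nra. }
  destruct (cluster_pt A 1) as [u Hu].
  - intros e He. destruct (Rle_lt_dec e 1) as [H|H].
    + apply HA1; lra.
    + destruct (HA1 1) as [u Hu]; [lra|]. exists u. apply HAm with 1; auto; lra.
  - intros e z He (H & _). rewrite dist2_sym, dist2_norm, norm_unit; [lra|].
    rewrite <- H. clear; coords; ring.
  - auto.
  - exists u. split; [split|].
    + apply unit_closed.
      intros e He. destruct (Hu e He) as [z [(Hz & _) Hd]]. exists z; auto.
    + intros k Hk.
      assert (H2 := norm_nonneg (vsub k c)).
      apply (le_of_le_add_eps _ _ (norm (vsub k c) + (norm v + 1))); [lra|].
      intros e He. destruct (Hu e He) as [z [(_ & _ & Hz) Hd]].
      specialize (Hz k Hk). assert (H1 := dot_le_dist2 u z (vsub k c)). nra.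
    + apply (le_of_le_add_eps 0 (dot u v) (1 + norm v)); [lra|].
      intros e He. destruct (Hu e He) as [z [(_ & Hz & _) Hd]].
      assert (H1 := dot_le_dist2 z u v). rewrite dist2_sym in H1. nra.
Qed.

Lemma unit_cross_zero (u v : pt) :
  dot u u = 1 -> dot v v = 1 -> cross u v = 0 -> v = u \/ v = (- fst u, - snd u).
Proof.
  intros Hu Hv Hc.
  assert (L := lagrange u v). rewrite Hu, Hv, Hc in L.
  assert (E : v = (dot u v * fst u, dot u v * snd u)).
  { destruct u as [a b], v as [c d]; unfold dot, cross in *; simpl in *.
    f_equal; nra. }
  assert (H : (dot u v - 1) * (dot u v + 1) = 0) by lra.
  apply Rmult_integral in H. destruct H as [H|H].
  - left. rewrite E. replace (dot u v) with 1 by lra. destruct u; simpl; f_equal; ring.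
  - right. rewrite E. replace (dot u v) with (-1) by lra. f_equal; ring.
Qed.

(** On the half circle to the left of [u] the angle grows as the cosine falls. *)
Lemma cross_sign_of_cos (u v w : pt) :
  dot u u = 1 -> dot v v = 1 -> dot w w = 1 ->
  0 <= cross u v -> 0 <= cross u w -> dot u w <= dot u v -> 0 <= cross v w.
Proof.
  intros Hu Hv Hw H1 H2 H3.
  assert (Lv := lagrange u v). assert (Lw := lagrange u w).
  rewrite Hu, Hv in Lv. rewrite Hu, Hw in Lw.
  replace (cross v w) with (dot u v * cross u w - cross u v * dot u w).
  2: { transitivity (dot u u * cross v w); [clear; coords; ring|rewrite Hu; ring]. }
  set (a := dot u v) in *. set (b := cross u v) in *.
  set (a' := dot u w) in *. set (b' := cross u w) in *.
  destruct (Rle_lt_dec 0 a'), (Rle_lt_dec 0 a).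
  - assert (b <= b') by nra. nra.
  - nra.
  - nra.
  - assert (b' <= b) by nra. nra.
Qed.

(** Meeting every closed half plane makes [U] surround the origin; excluding antipodal pairs makes
    all three turns strict. *)
Lemma contact_triple (U : pt -> Prop) :
  closed_set U -> (forall u, U u -> dot u u = 1) ->
  (forall u, U u -> ~ U (- fst u, - snd u)) ->
  (forall v, exists u, U u /\ 0 <= dot u v) ->
  exists u1 u2 u3, U u1 /\ U u2 /\ U u3 /\ positively_oriented u1 u2 u3.
Proof.
  intros Hcl Hunit Hanti Hdir.
  destruct (Hdir (0, 0)) as [u1 [H1 _]].
  assert (N1 := Hunit u1 H1).
  (* The sign [s] selects the side of [u1]; the farthest element there is the one with least
     cosine. *)
  assert (Hext : forall s, s * s = 1 -> exists w, U w /\ 0 <= s * cross u1 w /\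
            forall z, U z -> 0 <= s * cross u1 z -> dot u1 w <= dot u1 z).
  { intros s Hs.
    destruct (linear_min (fun z => U z /\ 0 <= s * cross u1 z) u1) as [w [[Hw Hw'] Hm]].
    - intros z Hz; split.
      + apply Hcl. intros e He. destruct (Hz e He) as [y [[Hy _] Hd]]. exists y; auto.
      + set (q := (- s * snd u1, s * fst u1)).
        assert (Eq : forall z, s * cross u1 z = dot q z)
          by (intros; unfold q; clear; coords; ring).
        rewrite Eq. apply (le_of_le_add_eps _ _ (norm q)); [apply norm_nonneg|].
        intros e He. destruct (Hz e He) as [y [[_ Hy] Hd]]. rewrite Eq in Hy.
        assert (H := dot_lipschitz q y z). rewrite dist2_sym in H.
        assert (H' := norm_nonneg q). nra.
    - exists 1. intros z [Hz _]. rewrite dist2_sym, dist2_norm, norm_unit; [lra|].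
      rewrite <- (Hunit z Hz). clear; coords; ring.
    - exists u1; split; auto. replace (cross u1 u1) with 0 by (clear; coords; ring). lra.
    - exists w; split; [auto|split; auto]. }
  (* u2 and u3 are the elements of U farthest from u1 on either side. *)
  destruct (Hext 1) as [u2 (H2 & S2 & M2)]; [lra|].
  destruct (Hext (-1)) as [u3 (H3 & S3 & M3)]; [lra|].
  assert (N2 := Hunit u2 H2). assert (N3 := Hunit u3 H3).
  assert (Anti : forall a b, cross a b = - cross b a) by (intros; clear; coords; ring).
  assert (Hz : forall u v, U u -> U v -> cross u v = 0 -> v = u).
  { intros u v Hu Hv Hc. destruct (unit_cross_zero u v) as [|E]; auto.
    exfalso. apply (Hanti u Hu). rewrite <- E; auto. }
  assert (Hpos : 0 < cross u2 u3).
  { apply Rnot_le_lt; intros Hle.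
    (* Otherwise all of [U] lies on the arc running counterclockwise from [u3] to [u2]. *)
    assert (Hall : forall u, U u -> 0 <= cross u u2 /\ 0 <= cross u3 u).
    { assert (I : forall u, cross u1 u2 * cross u3 u
                   = cross u u2 * cross u3 u1 + cross u1 u * cross u3 u2)
        by (intros; clear; coords; ring).
      assert (J : forall u, cross u3 u1 * cross u u2
                   = cross u3 u * cross u1 u2 + cross u u1 * cross u3 u2)
        by (intros; clear; coords; ring).
      assert (Hc32 := Anti u3 u2). assert (Hc31 := Anti u3 u1).
      intros u Hu. destruct (Rle_lt_dec 0 (cross u1 u)) as [Hs|Hs].
      - assert (A1 : 0 <= cross u u2).
        { apply (cross_sign_of_cos u1); auto; try lra. apply M2; auto; lra. }
        split; auto.
        destruct (Rle_lt_or_eq_dec 0 (cross u1 u2)) as [P|P]; [lra| |].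
        + specialize (I u). nra.
        + assert (u2 = u1) by (apply Hz; auto). subst u2.
          assert (u = u1); [|subst u; lra].
          apply Hz; auto. rewrite Anti in A1. lra.
      - assert (A1 : 0 <= cross u3 u).
        { rewrite Anti.
          assert (E : cross u u3 = - cross (fst u, - snd u) (fst u3, - snd u3))
            by (clear; coords; ring).
          rewrite E, Ropp_involutive.
          apply (cross_sign_of_cos (fst u1, - snd u1)).
          - rewrite <- N1; clear; coords; ring.
          - rewrite <- (Hunit u Hu); clear; coords; ring.
          - rewrite <- N3; clear; coords; ring.
          - replace (cross _ _) with (- cross u1 u) by (clear; coords; ring). lra.
          - replace (cross _ _) with (- cross u1 u3) by (clear; coords; ring). lra.
          - replace (dot (fst u1, - snd u1) (fst u3, - snd u3)) with (dot u1 u3)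
              by (clear; coords; ring).
            replace (dot (fst u1, - snd u1) (fst u, - snd u)) with (dot u1 u)
              by (clear; coords; ring).
            apply M3; auto; lra. }
        split; auto. specialize (J u). rewrite (Anti u u1) in J.
        destruct (Rle_lt_or_eq_dec 0 (cross u3 u1)) as [P|P]; [lra| |].
        + nra.
        + exfalso. assert (u3 = u1) by (apply Hz; auto; lra). subst u3. lra. }
    (* The test direction is [u2] minus [u3] turned by a quarter turn; on that arc its inner product
       is nonpositive, so the element found must equal both [u2] and [u3]. *)
    destruct (Hdir (- (snd u2 - snd u3), fst u2 - fst u3)) as [u [Hu Hd]].
    replace (dot u _) with (cross u2 u + cross u u3) in Hd by (clear; coords; ring).
    destruct (Hall u Hu) as [A1 A2].
    rewrite (Anti u2 u), (Anti u u3) in Hd.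
    assert (u = u2) by (symmetry; apply Hz; auto; lra).
    assert (u = u3) by (apply Hz; auto; lra).
    assert (E23 : u3 = u2) by congruence.
    assert (u2 = u1) by (apply Hz; auto; rewrite E23 in S3; lra).
    (* With all three equal, every element of [U] has inner product at least 1 with [u1], yet some
       element meets the opposite half plane. *)
    destruct (Hdir (- fst u1, - snd u1)) as [z [Hz1 Hz2]].
    replace (dot z _) with (- dot u1 z) in Hz2 by (clear; coords; ring).
    assert (dot u1 u2 <= dot u1 z).
    { destruct (Rle_lt_dec 0 (cross u1 z)); [apply M2; auto; lra|].
      rewrite <- E23. apply M3; auto; lra. }
    replace u2 with u1 in * by auto. lra. }
  exists u1, u2, u3. repeat (split; auto).
  - destruct (Rle_lt_or_eq_dec 0 (cross u1 u2)) as [P|P]; [lra|auto|].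
    assert (u2 = u1) by (apply Hz; auto). subst u2. lra.
  - rewrite Anti. destruct (Rle_lt_or_eq_dec 0 (- cross u1 u3)) as [P|P]; [lra|auto|].
    assert (u3 = u1) by (apply Hz; auto; lra). subst u3.
    rewrite Anti in Hpos. lra.
Qed.

(** * Triangle estimates: apex angle and circumradius *)

(** The last two hypotheses say that the angles at the ends of the base are not obtuse, so
    prolonging the two sides from the apex cannot shorten the base. *)
Lemma extended_side_ge (X Y : pt) (l m : R) :
  1 <= l -> 1 <= m -> dot X Y <= dot X X -> dot X Y <= dot Y Y ->
  dot (vsub X Y) (vsub X Y)
  <= dot (vsub (l * fst X, l * snd X) (m * fst Y, m * snd Y))
         (vsub (l * fst X, l * snd X) (m * fst Y, m * snd Y)).
Proof.
  intros Hl Hm H1 H2.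
  replace (dot (vsub X Y) (vsub X Y)) with (dot X X + dot Y Y - 2 * dot X Y)
    by (clear; coords; ring).
  replace (dot (vsub _ _) _) with (l * l * dot X X + m * m * dot Y Y - 2 * (l * m) * dot X Y)
    by (clear; coords; ring).
  assert (HX := dot_self_nonneg X). assert (HY := dot_self_nonneg Y).
  assert (0 <= l * l - 1) by nra. assert (0 <= m * m - 1) by nra.
  assert (0 <= l * m - 1) by nra.
  destruct (Rle_lt_dec 0 (dot X Y)).
  - assert (0 <= (l * l - 1) * (dot X X - dot X Y)) by (apply Rmult_le_pos; lra).
    assert (0 <= (m * m - 1) * (dot Y Y - dot X Y)) by (apply Rmult_le_pos; lra).
    assert (0 <= dot X Y * ((l - m) * (l - m))) by (apply Rmult_le_pos; [lra|apply Rle_0_sqr]).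
    lra.
  - assert (0 <= (l * l - 1) * dot X X) by (apply Rmult_le_pos; lra).
    assert (0 <= (m * m - 1) * dot Y Y) by (apply Rmult_le_pos; lra).
    assert (0 <= - dot X Y * (l * m - 1)) by (apply Rmult_le_pos; lra).
    lra.
Qed.

(* mp, mx, my below are the barycentric weights of the circumcenter, nonnegative
   because the triangle is not obtuse. *)
Lemma circumradius_bound (o p x y : pt) (Rc : R) :
  let X := vsub x p in let Y := vsub y p in
  0 <= dot X Y -> dot X Y <= dot X X -> dot X Y <= dot Y Y ->
  dot (vsub p o) (vsub p o) <= Rc * Rc ->
  dot (vsub x o) (vsub x o) <= Rc * Rc ->
  dot (vsub y o) (vsub y o) <= Rc * Rc ->
  cross X Y <> 0 ->
  dot X X * dot Y Y * dot (vsub x y) (vsub x y) <= 4 * (cross X Y * cross X Y) * (Rc * Rc).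
Proof.
  intros X Y H1 H2 H3 Hp Hx Hy Hc.
  set (A2 := dot Y Y). set (B2 := dot X X). set (D2 := dot (vsub x y) (vsub x y)).
  set (mp := D2 * (A2 + B2 - D2)). set (mx := A2 * (B2 + D2 - A2)).
  set (my := B2 * (A2 + D2 - B2)).
  assert (ED : D2 = A2 + B2 - 2 * dot X Y) by (unfold D2, A2, B2, X, Y; clear; coords; ring).
  assert (0 <= A2) by apply dot_self_nonneg. assert (0 <= B2) by apply dot_self_nonneg.
  assert (0 <= D2) by apply dot_self_nonneg.
  assert (Pp : 0 <= mp) by (apply Rmult_le_pos; lra).
  assert (Px : 0 <= mx) by (apply Rmult_le_pos; unfold A2, B2 in *; lra).
  assert (Py : 0 <= my) by (apply Rmult_le_pos; unfold A2, B2 in *; lra).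
  (* Heron's formula: both sides are sixteen times the squared area. *)
  assert (Es : mp + mx + my = 4 * (cross X Y * cross X Y)).
  { unfold mp, mx, my. rewrite ED.
    assert (L := lagrange X Y). fold A2 B2 in L.
    replace (cross X Y * cross X Y) with (B2 * A2 - dot X Y * dot X Y) by lra. ring. }
  assert (Hs : 0 < mp + mx + my) by (rewrite Es; nra).
  rewrite <- Es.
  set (W := mp * dot (vsub p o) (vsub p o) + mx * dot (vsub x o) (vsub x o)
            + my * dot (vsub y o) (vsub y o)).
  assert (W <= (mp + mx + my) * (Rc * Rc)).
  { unfold W. nra. }
  apply Rle_trans with W; auto.
  set (g := (mp * (fst p - fst o) + mx * (fst x - fst o) + my * (fst y - fst o),
             mp * (snd p - snd o) + mx * (snd x - snd o) + my * (snd y - snd o))).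
  (* Leibniz's identity for weighted points: the spread on the right does not depend on [o], so
     discarding the square of [g] bounds [W] from below. *)
  assert (E : (mp + mx + my) * W - dot g g = mp * mx * B2 + mp * my * A2 + mx * my * D2).
  { unfold W, g, A2, B2, D2, X, Y. clearbody mp mx my. clear; coords; ring. }
  assert (E2 : mp * mx * B2 + mp * my * A2 + mx * my * D2 = A2 * B2 * D2 * (mp + mx + my)).
  { unfold mp, mx, my. ring. }
  assert (Hg := dot_self_nonneg g).
  apply Rmult_le_reg_l with (mp + mx + my); auto. nra.
Qed.

(* X2 and Y2 are the sides px and py prolonged to the line <u, .> = r. Comparing twice
   the area h D2 of that triangle with the sum over its sides of length times the
   distance from the origin gives C4. *)
Lemma apex_angle_bound (u p x y : pt) (r h w D : R) :
  let X := vsub x p in let Y := vsub y p in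
  dot u u = 1 -> 0 < r -> 2 * r < w -> w <= h -> 0 < D ->
  dot u p = r - h -> dot u x <= r -> dot u y <= r ->
  dot u p < dot u x -> dot u p < dot u y ->
  Rabs (cross p x) <= r * norm X -> Rabs (cross p y) <= r * norm Y ->
  norm X <= D -> norm Y <= D -> dist2 x y = D ->
  0 < Rabs (cross X Y) /\
  Rabs (cross X Y) * (D * (w - 2 * r) / (2 * (r * r))) <= norm X * norm Y + dot X Y.
Proof.
  intros X Y Hu Hr Hw Hh HD Hp Hx Hy Hpx Hpy Lx Ly HX HY HxyD.
  assert (Nx := norm_nonneg X). assert (Ny := norm_nonneg Y).
  assert (SX := norm_sqr X). assert (SY := norm_sqr Y).
  assert (SD := dist2_sqr x y). rewrite HxyD in SD.
  replace (dot (vsub x y) (vsub x y)) with (dot X X + dot Y Y - 2 * dot X Y) in SD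
    by (unfold X, Y; clear; coords; ring).
  assert (UX : dot u X = dot u x - dot u p) by (unfold X; clear; coords; ring).
  assert (UY : dot u Y = dot u y - dot u p) by (unfold Y; clear; coords; ring).
  (* These factors carry [X] and [Y] to height [h]; they are at least 1 since [x] and [y] do not lie
     beyond the tangent line. *)
  set (l := h / dot u X). set (m := h / dot u Y).
  assert (El : l * dot u X = h) by (unfold l; field; lra).
  assert (Em : m * dot u Y = h) by (unfold m; field; lra).
  assert (Hl : 1 <= l) by (apply Rmult_le_reg_r with (dot u X); lra).
  assert (Hm : 1 <= m) by (apply Rmult_le_reg_r with (dot u Y); lra).
  clearbody l m.
  set (X2 := (l * fst X, l * snd X)). set (Y2 := (m * fst Y, m * snd Y)).
  assert (D2ge := extended_side_ge X Y l m Hl Hm ltac:(nra) ltac:(nra)).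
  fold X2 Y2 in D2ge.
  set (D2 := norm (vsub X2 Y2)).
  assert (D2n : 0 <= D2) by apply norm_nonneg.
  assert (D2s : D2 * D2 = dot (vsub X2 Y2) (vsub X2 Y2)) by apply norm_sqr.
  assert (HD2 : D <= D2).
  { apply le_of_sqr; auto. rewrite D2s.
    replace (dot (vsub X Y) (vsub X Y)) with (dot X X + dot Y Y - 2 * dot X Y) in D2ge
      by (clear; coords; ring). lra. }
  assert (D2E : D2 * D2 = l * l * dot X X + m * m * dot Y Y - 2 * (l * m) * dot X Y)
    by (rewrite D2s; unfold X2, Y2; clearbody X Y; clear; coords; ring).
  (* Signed length of the third side, which is parallel to the tangent line. *)
  set (t := cross u Y2 - cross u X2).
  assert (Ut : D2 = Rabs t).
  { assert (D2 * D2 = t * t).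
    { rewrite D2s.
      transitivity (dot u u * dot (vsub X2 Y2) (vsub X2 Y2)); [rewrite Hu; ring|].
      rewrite lagrange.
      replace (dot u (vsub X2 Y2)) with (l * dot u X - m * dot u Y)
        by (unfold X2, Y2; clearbody X Y; clear; coords; ring).
      replace (cross u (vsub X2 Y2)) with (- t)
        by (unfold t; clearbody X2 Y2; clear; coords; ring).
      rewrite El, Em. ring. }
    assert (Rabs t * Rabs t = t * t) by (rewrite <- Rabs_mult; apply Rabs_pos_eq; nra).
    assert (Ht := Rabs_pos t).
    apply Rle_antisym; apply le_of_sqr; auto; lra. }
  assert (C2 : l * m * cross X Y = h * t).
  { transitivity (dot u u * cross X2 Y2).
    - rewrite Hu. unfold X2, Y2; clearbody X Y; clear; coords; ring.
    - transitivity (dot u X2 * cross u Y2 - cross u X2 * dot u Y2).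
      + clearbody X2 Y2; clear; coords; ring.
      + replace (dot u X2) with (l * dot u X) by (unfold X2; clearbody X; clear; coords; ring).
        replace (dot u Y2) with (m * dot u Y) by (unfold Y2; clearbody Y; clear; coords; ring).
        rewrite El, Em. unfold t. ring. }
  assert (hpos : 0 < h) by lra.
  assert (lmpos : 0 < l * m) by nra.
  assert (C2a : l * m * Rabs (cross X Y) = h * D2).
  { assert (H := f_equal Rabs C2). rewrite !Rabs_mult in H.
    rewrite (Rabs_pos_eq l), (Rabs_pos_eq m), (Rabs_pos_eq h) in H by lra.
    rewrite Ut. lra. }
  (* Twice the signed area, split at the origin into the triangles over the three sides. *)
  assert (C3 : h * t = r * t + l * cross p x - m * cross p y).
  { rewrite <- C2.
    assert (r * t = (dot u p + l * dot u X) * (cross u p + cross u Y2)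
                    - (dot u p + m * dot u Y) * (cross u p + cross u X2)).
    { rewrite El, Em. unfold t. rewrite Hp. ring. }
    rewrite H.
    transitivity (dot u u * (l * m * cross X Y)); [rewrite Hu; ring|].
    transitivity ((dot u p + l * dot u X) * (cross u p + cross u Y2)
      - (dot u p + m * dot u Y) * (cross u p + cross u X2)
      + dot u u * (l * cross p x - m * cross p y)); [|rewrite Hu; ring].
    unfold X2, Y2, X, Y; clear; coords; ring. }
  set (E := l * norm X). set (F := m * norm Y).
  assert (En : 0 <= E) by (unfold E; nra). assert (Fn : 0 <= F) by (unfold F; nra).
  assert (C4 : h * D2 <= r * (D2 + E + F)).
  { replace (h * D2) with (Rabs (h * t)) by (rewrite Rabs_mult, (Rabs_pos_eq h), Ut; lra).
    rewrite C3.
    assert (T1 := Rabs_triang (r * t + l * cross p x) (- (m * cross p y))).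
    assert (T2 := Rabs_triang (r * t) (l * cross p x)).
    rewrite Rabs_Ropp, (Rabs_mult m), (Rabs_pos_eq m) in T1 by lra.
    rewrite (Rabs_mult r), (Rabs_mult l), (Rabs_pos_eq r), (Rabs_pos_eq l) in T2 by lra.
    rewrite <- Ut in T2. unfold Rminus. unfold E, F. nra. }
  (* Law of cosines for the prolonged triangle. *)
  assert (C5 : 2 * (l * m) * (norm X * norm Y + dot X Y) = (E + F) * (E + F) - D2 * D2).
  { rewrite D2E, <- SX, <- SY. unfold E, F. ring. }
  assert (C6 : (h - r) * D2 * ((h - r) * D2) <= r * (E + F) * (r * (E + F))).
  { assert (0 <= (h - r) * D2) by (apply Rmult_le_pos; lra).
    apply Rmult_le_compat; lra. }
  split.
  - assert (0 < h * D2) by (apply Rmult_lt_0_compat; lra). rewrite <- C2a in H.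
    apply Rmult_lt_reg_l with (l * m); lra.
  - apply Rmult_le_reg_l with (2 * (r * r) * (l * m)); [apply Rmult_lt_0_compat; nra|].
    replace (2 * (r * r) * (l * m) * (Rabs (cross X Y) * (D * (w - 2 * r) / (2 * (r * r)))))
      with ((l * m * Rabs (cross X Y)) * (D * (w - 2 * r))) by (field; lra).
    rewrite C2a.
    replace (2 * (r * r) * (l * m) * (norm X * norm Y + dot X Y))
      with (r * r * (2 * (l * m) * (norm X * norm Y + dot X Y))) by ring.
    rewrite C5.
    (* By [C5] and [C6] the right side is at least [h * (h - 2 * r) * (D2 * D2)]; it remains to
       compare [D] with [D2] and [w] with [h]. *)
    assert (D * (w - 2 * r) <= D2 * (h - 2 * r)) by (apply Rmult_le_compat; lra).
    assert (h * D2 * (D * (w - 2 * r)) <= h * D2 * (D2 * (h - 2 * r)))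
      by (apply Rmult_le_compat_l; nra).
    lra.
Qed.

(** * Scalar inequalities in [q] *)

(** With [d] and [cc] equal to [m] times the sine and cosine of phi, the cotangent k of phi/2
    satisfies k + 1/k = 2/sin phi, and t + 1/t increases for t at least 1. *)
Lemma half_angle_bound (q d cc m : R) :
  1 <= q -> 0 < d -> 0 <= m -> d * q <= m + cc -> m * m = d * d + cc * cc ->
  (q * q + 1) * d <= 2 * q * m.
Proof.
  intros Hq Hd Hm H E.
  set (g := m + cc) in *. assert (Hg : 0 < g) by nra.
  assert (Eg : g * g + d * d = 2 * m * g) by (unfold g; lra).
  assert (0 <= (g - d * q) * (q * g - d)) by (apply Rmult_le_pos; nra).
  apply Rmult_le_reg_r with g; auto. nra.
Qed.

(** The bound is the larger root of t^2 - 2Xt + 1. *)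
Lemma quadratic_root_bound (q X : R) :
  1 <= X -> q * q + 1 <= 2 * q * X -> q <= X * (1 + sqrt (1 - (/ X) ^ 2)).
Proof.
  intros HX Hq.
  assert (Hi : X * / X = 1) by (field; lra).
  set (i := / X) in *.
  assert (i <= 1) by nra. assert (0 < i) by nra.
  assert (Hs : 0 <= 1 - i ^ 2) by (simpl; nra).
  assert (H1 := sqrt_pos (1 - i ^ 2)). assert (H2 := sqrt_sqrt _ Hs).
  set (s := sqrt (1 - i ^ 2)) in *.
  assert (E : (X * s) * (X * s) = X * X - 1).
  { transitivity (X * X * (s * s)); [ring|]. rewrite H2.
    transitivity (X * X - (X * i) * (X * i)); [ring|rewrite Hi; ring]. }
  assert (q - X <= X * s); [|lra].
  apply le_of_sqr; [nra|]. rewrite E. nra.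
Qed.

(** * From the triangle back to the convex body *)

(** The incircle tangent with normal [u] and its parallel through [p] both support [K]; the center,
    strictly below that tangent, shows that they are distinct. *)
Lemma support_gap_ge_width (K : pt -> Prop) (c u p : pt) (r w : R) :
  is_width K w -> 0 < r -> (forall x, cball c r x -> K x) ->
  contact_direction K c r u -> K p -> (forall k, K k -> dot u p <= dot u k) ->
  w <= r - dot u (vsub p c).
Proof.
  intros [_ Hw] Hr Hin [Hu Huk] Hp Hmin.
  assert (E : forall z, dot u (vsub z c) = dot u z - dot u c)
    by (intros; clear; coords; ring).
  assert (Hball : forall s, Rabs s <= r ->
    exists z, K z /\ dot u z = dot u c + s).
  { intros s Hs. eexists; split; [apply (ball_point K c u r s); auto|].
    transitivity (dot u c + s * dot u u); [clear; coords; ring|rewrite Hu; ring]. }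
  destruct (Hball r) as [z [Hz Ez]]; [rewrite Rabs_pos_eq; lra|].
  destruct (Hball 0) as [z0 [Hz0 Ez0]]; [rewrite Rabs_R0; lra|].
  assert (H0 := Hmin z0 Hz0). rewrite E.
  assert (w <= dot u c + r - dot u p); [|lra].
  apply (Hw u). split; [auto|split; [lra|split; [|split; eauto]]].
  intros x Hx. specialize (Huk x Hx). rewrite E in Huk. specialize (Hmin x Hx). lra.
Qed.

Lemma diameter_le_two_circumradius (K : pt -> Prop) (D Rc : R) (x y o : pt) :
  K x -> K y -> dist2 x y = D -> (forall z, K z -> cball o Rc z) -> D <= 2 * Rc.
Proof.
  intros Hx Hy <- H. assert (H1 := H x Hx). assert (H2 := H y Hy).
  unfold cball in *. assert (H3 := dist2_triangle x o y). rewrite (dist2_sym x o) in H3.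
  lra.
Qed.

Lemma width_bound_of_ratio (r w D Rc : R) :
  0 < r -> 0 < D -> D <= 2 * Rc ->
  (1 < D * (w - 2 * r) / (2 * (r * r)) ->
   (D * (w - 2 * r) / (2 * (r * r)) * (D * (w - 2 * r) / (2 * (r * r))) + 1) * D
   <= 4 * (D * (w - 2 * r) / (2 * (r * r))) * Rc) ->
  w <= 2 * r * (1 + (2 * r * Rc) / (D ^ 2) * (1 + sqrt (1 - (D / (2 * Rc)) ^ 2))).
Proof.
  intros Hr HD HR H. set (q := D * (w - 2 * r) / (2 * (r * r))) in *.
  set (X := 2 * Rc / D).
  assert (EX : X * D = 2 * Rc) by (unfold X; field; lra).
  assert (Ew : w = 2 * r + 2 * (r * r) / D * q) by (unfold q; field; lra).
  assert (HX : 1 <= X) by (apply Rmult_le_reg_r with D; lra).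
  replace (D / (2 * Rc)) with (/ X) by (unfold X; field; lra).
  assert (Hq : q <= X * (1 + sqrt (1 - (/ X) ^ 2))).
  (* For [q] at most 1 the bound is immediate from [1 <= X]. *)
  { destruct (Rle_lt_dec q 1) as [H1|H1].
    - assert (H2 := sqrt_pos (1 - (/ X) ^ 2)). nra.
    - apply quadratic_root_bound; auto. apply Rmult_le_reg_r with D; auto.
      specialize (H H1). nra. }
  rewrite Ew.
  replace (2 * r * (1 + 2 * r * Rc / D ^ 2 * (1 + sqrt (1 - (/ X) ^ 2))))
    with (2 * r + 2 * (r * r) / D * (X * (1 + sqrt (1 - (/ X) ^ 2)))).
  - apply Rplus_le_compat_l, Rmult_le_compat_l; auto.
    left; apply Rdiv_lt_0_compat; nra.
  - generalize (sqrt (1 - (/ X) ^ 2)); intros s. unfold X. field. lra.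
Qed.

Theorem theorem3p6 (K : pt -> Prop) (r w D Rc : R) :
  convex_body K ->
  is_inradius K r -> is_width K w -> is_diameter K D -> is_circumradius K Rc ->
  w <= 2 * r * (1 + (2 * r * Rc) / (D ^ 2) *
                 (1 + sqrt (1 - (D / (2 * Rc)) ^ 2))).
Proof.
  intros (Hcv & Hcl & Hb & Hint) [[c Hin] Hmax] Hwid [(x & y & Hx & Hy & Hxy) HD] [[o Ho] _].
  assert (Hr : 0 < r).
  { destruct Hint as [c' [rho [Hrho H]]].
    assert (rho / 2 <= r); [|lra].
    apply (Hmax c'). intros z Hz. apply H. unfold cball in Hz. lra. }
  assert (HDpos : 0 < D).
  { assert (H1 := ball_point K c (1, 0) r r Hin ltac:(unfold dot; simpl; ring)
                    ltac:(rewrite Rabs_pos_eq; lra)).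
    assert (H2 := ball_point K c (1, 0) r 0 Hin ltac:(unfold dot; simpl; ring)
                    ltac:(rewrite Rabs_R0; lra)).
    assert (H3 := HD _ _ H1 H2).
    assert (H4 := fst_le_dist2 (fst c + r * fst (1, 0), snd c + r * snd (1, 0))
                    (fst c + 0 * fst (1, 0), snd c + 0 * snd (1, 0))).
    simpl in *. replace (fst c + r * 1 - (fst c + 0 * 1)) with r in H4 by ring.
    rewrite Rabs_pos_eq in H4; lra. }
  assert (HDR := diameter_le_two_circumradius K D Rc x y o Hx Hy Hxy Ho).
  apply width_bound_of_ratio; auto.
  set (q := D * (w - 2 * r) / (2 * (r * r))). intros Hq.
  assert (Hw : 2 * r < w).
  { assert (0 < q * (2 * (r * r))) by (apply Rmult_lt_0_compat; nra).
    replace (q * (2 * (r * r))) with (D * (w - 2 * r)) in H by (unfold q; field; lra).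
    nra. }
  assert (Hne : exists z, K z) by (exists x; auto).
  set (U := contact_direction K c r).
  destruct (contact_triple U) as (u1 & u2 & u3 & H1 & H2 & H3 & Hor).
  - apply contact_direction_closed.
  - intros u [Hu _]; auto.
  (* Two opposite contact normals would enclose [K] in a strip of width [2 * r], less than [w]. *)
  - intros u Hu [_ Hu'].
    destruct (linear_min K u Hcl Hb Hne) as [p [Hp Hpm]].
    assert (H := support_gap_ge_width K c u p r w Hwid Hr Hin Hu Hp Hpm).
    specialize (Hu' p Hp).
    replace (dot _ _) with (- dot u (vsub p c)) in Hu' by (clear; coords; ring). lra.
  - intros v. apply contact_direction_exists; auto.
  (* Any two of the three sectors share a bounding normal, which is put in the place of [uk]. *)
  - assert (Hsel : exists ui uj uk, U ui /\ U uj /\ U uk /\ positively_oriented ui uj uk /\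
      forall z, z = x \/ z = y ->
        (0 <= cross uj (vsub z c) /\ cross uk (vsub z c) <= 0) \/
        (0 <= cross uk (vsub z c) /\ cross ui (vsub z c) <= 0)).
    { assert (Or2 : positively_oriented u2 u3 u1) by (unfold positively_oriented in *; tauto).
      assert (Or3 : positively_oriented u3 u1 u2) by (unfold positively_oriented in *; tauto).
      destruct (sector_cover u1 u2 u3 (vsub x c) Hor) as [Sx|[Sx|Sx]];
      destruct (sector_cover u1 u2 u3 (vsub y c) Hor) as [Sy|[Sy|Sy]];
      first [ exists u1, u2, u3; repeat (split; auto); intros z [-> | ->]; tauto
            | exists u2, u3, u1; repeat (split; auto); intros z [-> | ->]; tauto
            | exists u3, u1, u2; repeat (split; auto); intros z [-> | ->]; tauto ]. }
    clear u1 u2 u3 H1 H2 H3 Hor.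
    destruct Hsel as (ui & uj & u & Hi & Hj & Hu & Hor & Hsel).
    destruct (linear_min K u Hcl Hb Hne) as [p [Hp Hpm]].
    assert (Hgap := support_gap_ge_width K c u p r w Hwid Hr Hin Hu Hp Hpm).
    assert (Hcap : forall z n, z = x \/ z = y -> dot n n = 1 ->
              r < dot n (vsub p c) -> r < dot n (vsub z c) -> False).
    { intros z n Hz Hn. assert (K z) by (destruct Hz; subst; auto).
      destruct Hi as [Ni Hi], Hj as [Nj Hj], Hu as [Nu Hu].
      apply (no_common_cap ui uj u n (vsub p c) (vsub z c) r); auto. lra. }
    assert (Eu : forall z, dot u (vsub z c) = dot u z - dot u c)
      by (intros; clear; coords; ring).
    assert (Hlow : forall z, z = x \/ z = y -> K z /\
      dot u (vsub p c) < dot u (vsub z c) /\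
      Rabs (cross (vsub p c) (vsub z c)) <= r * norm (vsub (vsub z c) (vsub p c))).
    { intros z Hz. assert (Kz : K z) by (destruct Hz; subst; auto).
      split; [auto|split].
      (* At the same height as [p], the point [z] would share with it the cap of normal opposite to
         [u], since that height is below [- r]. *)
      - destruct (Rle_lt_or_eq_dec _ _ (Hpm z Kz)) as [|E]; [rewrite !Eu; lra|exfalso].
        destruct Hu as [Nu _].
        apply (Hcap z (- fst u, - snd u) Hz).
        + rewrite <- Nu; clear; coords; ring.
        + replace (dot _ _) with (- dot u (vsub p c)) by (clear; coords; ring). lra.
        + replace (dot _ _) with (- dot u (vsub z c)) by (clear; coords; ring).
          rewrite Eu, <- E, <- Eu. lra.
      - apply line_distance; auto. intros n Hn. apply Hcap; auto. }
    destruct (Hlow x (or_introl eq_refl)) as (_ & Lx & Cx).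
    destruct (Hlow y (or_intror eq_refl)) as (_ & Ly & Cy).
    assert (Es : forall a b, vsub (vsub a c) (vsub b c) = vsub a b)
      by (intros; unfold vsub; simpl; f_equal; ring).
    assert (Dx := HD x p Hx Hp). assert (Dy := HD y p Hy Hp).
    rewrite dist2_norm in Dx, Dy.
    destruct Hu as [Nu Hu].
    destruct (apex_angle_bound u (vsub p c) (vsub x c) (vsub y c) r
      (r - dot u (vsub p c)) w D) as [Hpos Hang]; rewrite ?Es; auto; try lra.
    { rewrite Es in Cx; auto. }
    { rewrite Es in Cy; auto. }
    { rewrite dist2_norm, Es, <- dist2_norm; auto. }
    rewrite !Es in Hpos, Hang. fold q in Hang.
    set (X := vsub x p) in *. set (Y := vsub y p) in *.
    assert (SX := norm_sqr X). assert (SY := norm_sqr Y).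
    assert (NX := norm_nonneg X). assert (NY := norm_nonneg Y).
    assert (SD := dist2_sqr x y). rewrite Hxy in SD.
    assert (ED : dot (vsub x y) (vsub x y) = dot X X + dot Y Y - 2 * dot X Y)
      by (unfold X, Y; clear; coords; ring).
    assert (Ea : Rabs (cross X Y) * Rabs (cross X Y) = cross X Y * cross X Y)
      by (rewrite <- Rabs_mult; apply Rabs_pos_eq; nra).
    assert (L := lagrange X Y). rewrite <- Ea, <- SX, <- SY in L.
    set (m := norm X * norm Y) in *.
    assert (Hm : 0 <= m) by (apply Rmult_le_pos; auto).
    assert (Hhalf : (q * q + 1) * Rabs (cross X Y) <= 2 * q * m).
    { apply half_angle_bound with (dot X Y); auto; unfold m in *; lra. }
    (* Here [q > 1] enters: sin phi < 1 + cos phi is impossible for an obtuse angle phi at [p]. *)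
    assert (Hcc : 0 <= dot X Y).
    { apply Rnot_lt_le; intros Hneg.
      assert (m * m = Rabs (cross X Y) * Rabs (cross X Y) + dot X Y * dot X Y)
        by (unfold m; lra).
      assert (Rabs (cross X Y) - dot X Y < m) by nra.
      assert ((Rabs (cross X Y) - dot X Y) * (Rabs (cross X Y) - dot X Y) < m * m)
        by (apply Rmult_le_0_lt_compat; lra).
      nra. }
    assert (Hcirc : forall z, K z -> dot (vsub z o) (vsub z o) <= Rc * Rc).
    { intros z Hz. assert (H := Ho z Hz). unfold cball in H. rewrite dist2_sym in H.
      rewrite <- dist2_sqr. assert (H' := dist2_nonneg z o). nra. }
    assert (Hcr := circumradius_bound o p x y Rc Hcc).
    fold X Y in Hcr. rewrite <- SX, <- SY, <- Ea, <- SD in Hcr.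
    (* Square root of the circumradius bound; multiplied into [Hhalf], it leaves only the positive
       factor [Rabs (cross X Y)] to cancel. *)
    assert (HmD : m * D <= 2 * Rabs (cross X Y) * Rc).
    { apply le_of_sqr; [nra|]. unfold m.
      assert (Hc0 : cross X Y <> 0) by (intros E; rewrite E, Rabs_R0 in Hpos; lra).
      specialize (Hcr ltac:(nra) ltac:(nra) (Hcirc p Hp) (Hcirc x Hx) (Hcirc y Hy) Hc0).
      lra. }
    apply Rmult_le_reg_r with (Rabs (cross X Y)); auto. nra.
Qed.
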